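(* Suppose that the uncertainty set is a polytope, that is, $\Xi=\{\xi\in\mathbb{R}^m:C\xi\le d\}$ where $C$ is a matrix and $d$ a vector of appropriate dimensions. Consider the affine functions $a_k(\xi)=\langle a_k,\xi\rangle+b_k$, with $a_k\in\mathbb{R}^m$, $b_k\in\mathbb{R}$, for all $k\le K$, and let $\varepsilon\ge0$. (i) If $\ell(\xi)=\max_{k\le K}a_k(\xi)$, then the worst-case expectation $\sup_{\mathbb{Q}\in\mathbb{B}_\varepsilon(\widehat{\mathbb{P}}_N)}\mathbb{E}^{\mathbb{Q}}[\ell(\xi)]$ evaluates to $$\begin{array}{cll}\inf\limits_{\lambda,s_i,\gamma_{ik}}&\lambda\varepsilon+\frac1N\sum\limits_{i=1}^Ns_i&\\ \text{s.t.}&b_k+\langle a_k,\widehat\xi_i\rangle+\langle\gamma_{ik},d-C\widehat\xi_i\rangle\le s_i&\forall i\le N,\ \forall k\le K\\ &\|C^\top\gamma_{ik}-a_k\|_*\le\lambda&\forall i\le N,\ \forall k\le K\\ &\gamma_{ik}\ge0&\forall i\le N,\ \forall k\le K.\end{array}$$ (ii) If $\ell(\xi)=\min_{k\le K}a_k(\xi)$, then the worst-case expectation $\sup_{\mathbb{Q}\in\mathbb{B}_\varepsilon(\widehat{\mathbb{P}}_N)}\mathbb{E}^{\mathbb{Q}}[\ell(\xi)]$ evaluates to $$\begin{array}{cll}\inf\limits_{\lambda,s_i,\gamma_i,\theta_i}&\lambda\varepsilon+\frac1N\sum\limits_{i=1}^Ns_i&\\ \text{s.t.}&\langle\theta_i,b+A\widehat\xi_i\rangle+\langle\gamma_i,d-C\widehat\xi_i\rangle\le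 s_i&\forall i\le N\\ &\|C^\top\gamma_i-A^\top\theta_i\|_*\le\lambda&\forall i\le N\\ &\langle\theta_i,e\rangle=1&\forall i\le N\\ &\gamma_i\ge0&\forall i\le N\\ &\theta_i\ge0&\forall i\le N,\end{array}$$ where $A$ is the matrix with rows $a_k^\top$, $k\le K$, $b$ is the column vector with entries $b_k$, $k\le K$, and $e$ is the vector of all ones.
   Context: Notation: $\langle a,b\rangle=a^\top b$; $\|\cdot\|$ is an arbitrary norm on $\mathbb{R}^m$ with dual norm $\|z\|_*=\sup_{\|\xi\|\le1}\langle z,\xi\rangle$; vector inequalities are componentwise. $\lambda$ and $s_i$ are real; $\gamma_{ik},\gamma_i,\theta_i$ are real vectors of matching dimension. Data and ball: $\widehat\xi_1,\dots,\widehat\xi_N\in\Xi$ are given points and $\widehat{\mathbb{P}}_N=\frac1N\sum_{i=1}^N\delta_{\widehat\xi_i}$. $\mathcal{M}(\Xi)$ is the set of probability distributions $\mathbb{Q}$ supported on $\Xi$ with $\mathbb{E}^{\mathbb{Q}}[\|\xi\|]<\infty$; $d_{\mathrm W}(\mathbb{Q}_1,\mathbb{Q}_2)=\inf_\Pi\int_{\Xi^2}\|\xi_1-\xi_2\|\,\Pi(d\xi_1,d\xi_2)$ over joint distributions $\Pi$ with marginals $\mathbb{Q}_1,\mathbb{Q}_2$; $\mathbb{B}_\varepsilon(\widehat{\mathbb{P}}_N)=\{\mathbb{Q}\in\mathcal{M}(\Xi):d_{\mathrm W}(\widehat{\mathbb{P}}_N,\mathbb{Q})\le\varepsilon\}$.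 *)

(* Defs.v *)
From HB Require Import structures.
From mathcomp Require Export all_boot all_order all_algebra.
From mathcomp Require Export all_classical all_reals all_analysis.

Set Implicit Arguments.
Unset Strict Implicit.
Unset Printing Implicit Defensive.

Export Order.TTheory GRing.Theory Num.Theory numFieldNormedType.Exports.

Local Open Scope classical_set_scope.
Local Open Scope ring_scope.

Section Vectors.
Context {R : realType}.

Definition dot {m : nat} (a b : 'cV[R]_m) : R := (a^T *m b) ord0 ord0.

Definition cv_le {m : nat} (u v : 'cV[R]_m) : Prop :=
  forall i, u i ord0 <= v i ord0.

(* An arbitrary norm is a function rather than the structural norm of the
   library, which on matrices is the max norm. *)
Definition is_norm {m : nat} (nrm : 'cV[R]_m -> R) : Prop :=
  [/\ forall x y, nrm (x + y) <= nrm x + nrm y,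
      forall (c : R) x, nrm (c *: x) = `|c| * nrm x &
      forall x, nrm x = 0 -> x = 0].

(* Extended-real valued so that the supremum needs no boundedness proof; for
   an actual norm it is always finite. *)
Definition dual_norm {m : nat} (nrm : 'cV[R]_m -> R) (z : 'cV[R]_m) : \bar R :=
  ereal_sup [set (dot z x)%:E | x in [set x | nrm x <= 1]].

Definition polyhedron {m p : nat} (C : 'M[R]_(p, m)) (d : 'cV[R]_p) :
    set 'cV[R]_m :=
  [set x | cv_le (C *m x) d].

End Vectors.

(* R^m with its Borel sigma-algebra; the carrier is 'cV[R]_m itself. *)
Notation borel_cV R m := (g_sigma_algebraType (@open 'cV[R]_m)).

Section Empirical.
Local Open Scope ereal_scope.
Context d (T : measurableType d) (R : realType) (N : nat) (xi : 'I_N -> T).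

Definition empirical (A : set T) : \bar R :=
  ((N%:R : R)^-1)%:E * \sum_(i < N) \d_(xi i) A.

Let empirical0 : empirical set0 = 0.
Proof. by rewrite /empirical big1 ?mule0// => i _; rewrite measure0. Qed.

Let empirical_ge0 A : 0 <= empirical A.
Proof. by rewrite /empirical mule_ge0 ?lee_fin ?invr_ge0// sume_ge0. Qed.

Let empirical_sigma_additive : semi_sigma_additive empirical.
Proof.
have E0 : (0 <= (N%:R : R)^-1)%R by rewrite invr_ge0.
pose f n : {measure set T -> \bar R} :=
  if insub n is Some i then \d_(xi i) else mzero.
have -> : empirical = mscale (NngNum E0) (msum f N).
  apply/funext => A; rewrite /mscale /msum /empirical /=; congr (_ * _).
  by apply: eq_bigr => i _; rewrite /f valK.
exact: measure_semi_sigma_additive.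
Qed.

HB.instance Definition _ := isMeasure.Build _ _ _ empirical
  empirical0 empirical_ge0 empirical_sigma_additive.

End Empirical.
Arguments empirical {d T} R {N} xi.

Section Wasserstein.
Local Open Scope ereal_scope.
Context {R : realType} {m : nat}.
Local Notation T := (borel_cV R m).
Implicit Types (nrm : 'cV[R]_m -> R) (Xi : set 'cV[R]_m).

(* Laws on R^m carried by Xi, with finite first moment. *)
Definition distributions nrm Xi : set (probability T R) :=
  [set Q : probability T R | Q Xi = 1 /\ 'E_Q[nrm] < +oo].

Definition couplings (mu nu : {measure set T -> \bar R}) :
    set (probability (T * T)%type R) :=
  [set Pi : probability (T * T)%type R |
    forall A : set T, measurable A ->
      pushforward Pi fst A = mu A /\ pushforward Pi snd A = nu A].

Definition wasserstein nrm Xi (mu nu : {measure set T -> \bar R}) : \bar R :=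
  ereal_inf [set \int[Pi]_(z in Xi `*` Xi) (nrm (z.1 - z.2)%R)%:E
            | Pi in couplings mu nu].

Definition wasserstein_ball nrm Xi (eps : R) (mu : {measure set T -> \bar R}) :
    set (probability T R) :=
  [set Q | distributions nrm Xi Q /\ wasserstein nrm Xi mu Q <= eps%:E].

Definition worst_case_expectation nrm Xi (eps : R) {N : nat}
    (xi : 'I_N -> T) (ell : 'cV[R]_m -> R) : \bar R :=
  ereal_sup [set 'E_Q[ell]
            | Q in wasserstein_ball nrm Xi eps (empirical R xi)].

End Wasserstein.

(* Main.v *)
Require Import Defs.
From mathcomp Require Import measurable_realfun ring lra.

Set Implicit Arguments.
Unset Strict Implicit.
Unset Printing Implicit Defensive.

Local Open Scope classical_set_scope.
Local Open Scope ring_scope.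

(** Both identities come from one fact that has nothing to do with polytopes
    (worst_case_semi_dual): for a Lipschitz loss, the worst-case expectation
    over the ball equals the infimum of lam * eps + (1/N) sum_i s_i over those
    lam >= 0 and s for which
      ell x <= s_i + lam * |x - xi_i|   for every i and every x in Xi.       (1)
    What remains is to recognise, for a fixed lam, s and i, that (1) holds
    exactly when multipliers gamma (and theta) as in the corollary exist.

    Weak half of the first fact.  From (1), ell y <= S x + lam * |x - y| with
    S x = min_i (s_i + lam * |x - xi_i|), for all x and all y in Xi.  This is
    integrated against a nearly optimal coupling; the first marginal only sees
    S xi_i <= s_i (semi_dual_weak).

    Strong half.  Moving each data point xi_i to a point z_i of Xi has a
    transport cost and a mean loss.  A mixture of two such displaced empirical
    laws whose mean cost is at most eps lies in the ball, so its mean loss is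
    at most the worst case V.  For eps > 0 this is a statement about pairs
    (cost, loss) in the plane, and an elementary separation
    (plane_separation) yields a slope lam >= 0 with
    loss z - lam * cost z <= V - lam * eps for all z; for eps = 0 the Lipschitz
    constant is such a slope.  The points z_i can now be optimised one by one,
    and s_i is the resulting supremum (semi_dual_strong).  Mixtures of two
    measures suffice, so neither minimax theorems nor compactness of the
    ball enter.

    From (1) to multipliers.  If an affine function, or a minimum of affine
    functions, is at most s + lam * |x - x0| on the polyhedron, then
    a hyperplane separates the concave side from the norm cone
    (affine_sandwich): some linear h has dual norm at most lam, and
    the concave function stays below s + h (x - x0) on the polyhedron.  The
    last inequality is purely polyhedral, so Farkas' lemma certifies it by
    nonnegative multipliers (polyhedral_dual_certificate).  Doing the norm
    first and the inequalities second is what avoids any Slater condition on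
    the polyhedron.  The separation is proved by tilting along one coordinate
    at a time, each step being plane_separation again. *)

(** * Separation in finite dimension *)

Section Convexity.
Context {R : realType}.

(** If no mixture of points of [S] hits the vertical axis below the origin,
    some line through the origin lies below [S]: every slope seen from a point
    on the left is at most every slope seen from a point on the right, and the
    supremum of the former serves. *)
Lemma plane_separation (S : R -> R -> Prop) :
  (exists t r, S t r /\ t < 0) -> (exists t r, S t r /\ 0 < t) ->
  (forall t r t' r' w, S t r -> S t' r' -> 0 <= w <= 1 ->
     w * t + (1 - w) * t' = 0 -> 0 <= w * r + (1 - w) * r') ->
  exists c, forall t r, S t r -> c * t <= r.
Proof.
move=> [t1 [r1 [S1 t1_lt0]]] [t2 [r2 [S2 t2_gt0]]] mixS.
have slope t r t' r' : S t r -> S t' r' -> t < 0 -> 0 < t' ->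
    r / t <= r' / t'.
  move=> Sr Sr' t0 t'0; have d0 : 0 < t' - t by lra.
  have w01 : 0 <= t' / (t' - t) <= 1.
    apply/andP; split; first by apply: divr_ge0; exact: ltW.
    rewrite ler_pdivrMr// mul1r; lra.
  have := mixS _ _ _ _ _ Sr Sr' w01.
  have -> : 1 - t' / (t' - t) = - t / (t' - t) by field; lra.
  have -> : t' / (t' - t) * t + - t / (t' - t) * t' = 0 by field; lra.
  have -> : t' / (t' - t) * r + - t / (t' - t) * r'
            = (t' * r - t * r') / (t' - t) by field; lra.
  move=> /(_ erefl); rewrite pmulr_lge0 ?invr_gt0// => h.
  rewrite ler_pdivlMr// mulrAC ler_ndivrMr//; lra.
pose L := [set x | exists t r, [/\ S t r, t < 0 & x = r / t]].
have L0 : has_sup L.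
  split; first by exists (r1 / t1), t1, r1.
  by exists (r2 / t2) => _ [t [r [Sr t0 ->]]]; exact: slope S2 t0 t2_gt0.
exists (sup L) => t r Sr; case: (ltrgtP t 0) => [t0|t0|t0].
- rewrite -ler_ndivrMr//; apply: sup_upper_bound => //; by exists t, r.
- rewrite -ler_pdivlMr//; apply: ge_sup; first by case: L0.
  by move=> _ [t' [r' [Sr' t'0 ->]]]; exact: slope Sr' Sr t'0 t0.
- have w01 : 0 <= (1 : R) <= 1 by rewrite ler01 lexx.
  have := mixS t r t r 1 Sr Sr w01; rewrite t0; lra.
Qed.

(** A subset of [V * R] is written as a relation, and is convex as a subset;
    it plays the role of the epigraph of a convex function, without any
    infimum having to be taken. *)
Definition convex_graph (V : lmodType R) (E : V -> R -> Prop) :=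
  forall x r x' r' w, E x r -> E x' r' -> 0 <= w <= 1 ->
    E (w *: x + (1 - w) *: x') (w * r + (1 - w) * r').

Lemma tilt_direction (V : lmodType R) (v : V) (E : V -> R -> Prop) :
  convex_graph E -> (forall x, exists r, E x r) ->
  (forall r, E 0 r -> 0 <= r) ->
  exists c, forall t r, E (t *: v) r -> c * t <= r.
Proof.
move=> cE totE posE; apply: plane_separation.
- by have [r Er] := totE (- 1 *: v); exists (-1), r; split => //; lra.
- by have [r Er] := totE (1 *: v); exists 1, r; split => //; lra.
move=> t r t' r' w Er Er' w01 tt'; apply: posE.
by have := cE _ _ _ _ _ Er Er' w01; rewrite !scalerA -scalerDl tt' scale0r.
Qed.

Lemma dotE m (x y : 'cV[R]_m) : dot x y = \sum_i x i ord0 * y i ord0.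
Proof. by rewrite /dot mxE; apply: eq_bigr => i _; rewrite mxE. Qed.

Lemma dotC m (x y : 'cV[R]_m) : dot x y = dot y x.
Proof. by rewrite !dotE; apply: eq_bigr => i _; rewrite mulrC. Qed.

Lemma dotDr m (x y z : 'cV[R]_m) : dot x (y + z) = dot x y + dot x z.
Proof. by rewrite /dot mulmxDr mxE. Qed.

Lemma dotZr m (x y : 'cV[R]_m) c : dot x (c *: y) = c * dot x y.
Proof. by rewrite /dot -scalemxAr mxE. Qed.

Lemma dotBr m (x y z : 'cV[R]_m) : dot x (y - z) = dot x y - dot x z.
Proof. by rewrite dotDr -scaleN1r dotZr mulN1r. Qed.

Lemma dotBl m (x y z : 'cV[R]_m) : dot (x - y) z = dot x z - dot y z.
Proof. by rewrite dotC dotBr dotC [dot z y]dotC. Qed.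

Lemma dot0r m (x : 'cV[R]_m) : dot x 0 = 0.
Proof. by rewrite /dot mulmx0 mxE. Qed.

Lemma dot_trmx m p (C : 'M[R]_(p, m)) (g : 'cV[R]_p) x :
  dot (C^T *m g) x = dot g (C *m x).
Proof. by rewrite /dot trmx_mul trmxK mulmxA. Qed.

Lemma dot_ge0 m (x y : 'cV[R]_m) : cv_le 0 x -> cv_le 0 y -> 0 <= dot x y.
Proof.
move=> x0 y0; rewrite dotE sumr_ge0// => i _.
by rewrite mulr_ge0//; [have := x0 i|have := y0 i]; rewrite mxE.
Qed.

(** Hahn-Banach for a convex set over the whole space that meets the vertical
    axis nowhere below the origin.  For each basis direction [j] the set is
    enlarged by all its translates along ([dir j], [c]), with [c] chosen by
    [tilt_direction] so that the axis is still met nowhere below the origin.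
    After all directions are used, any point can be slid onto the axis. *)
Lemma convex_graph_minorant m (E : 'cV[R]_m -> R -> Prop) :
  convex_graph E -> (forall x, exists r, E x r) ->
  (forall r, E 0 r -> 0 <= r) ->
  exists h, forall x r, E x r -> dot h x <= r.
Proof.
move=> cE totE posE.
pose dir (j : 'I_m) : 'cV[R]_m := delta_mx j ord0.
have tilt (js : seq 'I_m) : exists (h : 'I_m -> R) (F : 'cV[R]_m -> R -> Prop),
    [/\ convex_graph F, forall x r, E x r -> F x r,
        forall r, F 0 r -> 0 <= r &
        forall j t x r, j \in js -> F x r -> F (x + t *: dir j) (r + h j * t)].
  elim: js => [|j js [h [F [cF EF posF invF]]]].
    by exists (fun=> 0), E; split.
  have totF x : exists r, F x r.
    by have [r /EF Fr] := totE x; exists r.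
  have [c cP] := tilt_direction (dir j) cF totF posF.
  pose h' i := if i == j then c else h i.
  exists h', (fun x r => exists t, F (x + t *: dir j) (r + c * t)); split.
  - move=> x r x' r' w [t Fr] [t' Fr'] w01.
    exists (w * t + (1 - w) * t').
    have := cF _ _ _ _ _ Fr Fr' w01.
    rewrite !scalerDr !scalerA addrACA -scalerDl.
    by rewrite !mulrDr addrACA [w * (c * t)]mulrCA [_ * (c * t')]mulrCA.
  - by move=> x r /EF Fr; exists 0; rewrite scale0r mulr0 !addr0.
  - move=> r [t]; rewrite add0r => /cP; lra.
  - move=> i t x r; rewrite inE /h' => ijs [u Fu].
    have [->|ij] := eqVneq i j.
      exists (u - t); rewrite -!addrA -scalerDl -mulrDr [t + _]addrC subrK.
      exact: Fu.
    move: ijs; rewrite (negPf ij)/= => ijs; exists u.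
    rewrite addrAC [_ + _ * t + _]addrAC; exact: invF.
have [h [F [_ EF posF invF]]] := tilt (enum 'I_m).
exists (\col_j h j) => x r /EF Fx.
(* Slide the point (x, r) of F along the basis directions. *)
have strip (js : seq 'I_m) :
    F (x - \sum_(j <- js) x j ord0 *: dir j) (r - \sum_(j <- js) h j * x j ord0).
  elim: js => [|j js ih]; first by rewrite !big_nil !subr0.
  have := invF j (- x j ord0) _ _ (mem_enum _ j) ih.
  rewrite !big_cons scaleNr mulrN !opprD.
  by rewrite [- (_ *: dir j) - _]addrC [- (h j * _) - _]addrC !addrA.
have := strip (enum 'I_m); rewrite !big_enum/=.
have <- : x = \sum_j x j ord0 *: dir j.
  rewrite [LHS]matrix_sum_delta; apply: eq_bigr => i _.
  by rewrite big_ord1.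
rewrite subrr => /posF; rewrite subr_ge0 => /(le_trans _); apply.
by rewrite dotE ler_sum// => j _; rewrite mxE.
Qed.

End Convexity.

(** * Farkas' lemma *)

Section LinearInequalities.
Context {R : realType}.

(** Induction on the number of forms.  If the last form [fm] cannot be dropped,
    a point [x0] violates the implication without it, so [fm x0 > 0]; projecting
    along [x0] onto the kernel of [fm] removes [fm] from the system, and the
    multiplier of [fm] is then forced, nonnegative by the choice of [x0]. *)
Lemma farkas_ord (V : lmodType R) n (f : 'I_n -> V -> R) (g : V -> R) :
  (forall i, scalar (f i)) -> scalar g ->
  (forall x, (forall i, f i x <= 0) -> g x <= 0) ->
  exists2 w : 'I_n -> R, forall i, 0 <= w i &
    forall x, g x = \sum_i w i * f i x.
Proof.
elim: n f g => [|n IH] f g linf ling fg.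
  exists (fun=> 0) => // x; rewrite big_ord0.
  have gN : g (- x) = - g x.
    have := ling (-1) x 0; have := ling (-1) 0 0.
    rewrite !addr0 scaler0 !scaleN1r; lra.
  have : g x <= 0 by apply: fg => -[].
  have : g (- x) <= 0 by apply: fg => -[].
  by rewrite gN; lra.
pose f' (i : 'I_n) := f (lift ord_max i).
have [fg'|] := pselect (forall x, (forall i, f' i x <= 0) -> g x <= 0).
  have [w w0 gw] := IH f' g (fun i => linf _) ling fg'.
  exists (fun i => oapp w 0 (unlift ord_max i)).
    by move=> i; case: unliftP => [j|] /= _; rewrite ?w0.
  move=> x; rewrite gw (bigD1_ord ord_max)//= unlift_none/= mul0r add0r.
  by apply: eq_bigr => i _; rewrite liftK.
move=> /existsNP[x0 /not_implyP[fx0 /negP]]; rewrite -ltNge => gx0.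
have fm0 : 0 < f ord_max x0.
  rewrite ltNge; apply/negP => fm0; suff : g x0 <= 0 by lra.
  by apply: fg => i; case: (unliftP ord_max i) => [j ->|->//]; exact: fx0.
set fm := f ord_max in fm0 *.
pose proj (h : V -> R) x := h x - h x0 / fm x0 * fm x.
have proj_lin h : scalar h -> scalar (proj h).
  by move=> linh c u v; rewrite /proj linh /fm linf; ring.
have projE h x : scalar h -> h (- (fm x / fm x0) *: x0 + x) = proj h x.
  by move=> linh; rewrite linh /proj; field; lra.
have [|w w0 gw] := IH (fun i => proj (f' i)) (proj g)
    (fun i => proj_lin _ (linf _)) (proj_lin _ ling).
  move=> x fx; rewrite -projE//; apply: fg => i.
  rewrite projE//; case: (unliftP ord_max i) => [j ->|->]; first exact: fx.
  by rewrite /proj -/fm divff ?mul1r ?subrr//; lra.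
pose c := (g x0 - \sum_i w i * f' i x0) / fm x0.
have c0 : 0 <= c.
  rewrite divr_ge0 ?(ltW fm0)// subr_ge0 (le_trans _ (ltW gx0))//.
  by rewrite sumr_le0// => i _; rewrite mulr_ge0_le0.
exists (fun i => oapp w c (unlift ord_max i)).
  by move=> i; case: unliftP => [j|] /= _; rewrite ?w0.
move=> x; rewrite (bigD1_ord ord_max)//= unlift_none/= -/fm.
under eq_bigr do rewrite liftK/=.
have -> : g x = proj g x + g x0 / fm x0 * fm x by rewrite /proj subrK.
rewrite gw /= /proj /c; under eq_bigr do rewrite mulrBr.
rewrite sumrB.
have -> : \sum_i w i * (f' i x0 / fm x0 * fm x) =
    (\sum_i w i * f' i x0) / fm x0 * fm x.
  by rewrite !mulr_suml; apply: eq_bigr => i _; rewrite !mulrA.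
rewrite /f'; ring.
Qed.

Lemma farkas (V : lmodType R) (I : finType) (f : I -> V -> R) (g : V -> R) :
  (forall i, scalar (f i)) -> scalar g ->
  (forall x, (forall i, f i x <= 0) -> g x <= 0) ->
  exists2 w : I -> R, forall i, 0 <= w i &
    forall x, g x = \sum_i w i * f i x.
Proof.
move=> linf ling fg.
have [|w w0 gw] := @farkas_ord V #|I| (f \o enum_val) g (fun i => linf _) ling.
  by move=> x fx; apply: fg => i; rewrite -[i]enum_rankK; exact: fx.
exists (w \o enum_rank) => [i|x]; first exact: w0.
rewrite gw [RHS](reindex _ (onW_bij _ (@enum_val_bij I)))/=.
by apply: eq_bigr => i _; rewrite enum_valK.
Qed.

End LinearInequalities.

(** * Arbitrary norms and their duals *)

Section Norm.
Context {R : realType} {m : nat} (nrm : 'cV[R]_m -> R).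
Hypothesis hnrm : is_norm nrm.

Lemma nrmD x y : nrm (x + y) <= nrm x + nrm y.
Proof. by case: hnrm. Qed.

Lemma nrmZ c x : nrm (c *: x) = `|c| * nrm x.
Proof. by case: hnrm. Qed.

Lemma nrm0 : nrm 0 = 0.
Proof. by rewrite -(scale0r 0) nrmZ normr0 mul0r. Qed.

Lemma nrmN x : nrm (- x) = nrm x.
Proof. by rewrite -scaleN1r nrmZ normrN1 mul1r. Qed.

Lemma nrm_ge0 x : 0 <= nrm x.
Proof. by have := nrmD x (- x); rewrite subrr nrm0 nrmN; lra. Qed.

Lemma nrmB x y : nrm (x - y) = nrm (y - x).
Proof. by rewrite -nrmN opprB. Qed.

(** The bound on the unit ball extends to all vectors by homogeneity; vectors
    of norm zero are null, so scaling is always possible. *)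
Lemma dual_norm_leP (z : 'cV[R]_m) (lam : R) :
  (dual_norm nrm z <= lam%:E)%E <->
  0 <= lam /\ forall y, dot z y <= lam * nrm y.
Proof.
split=> [zlam|[lam0 zlam]]; last first.
  apply: ge_ereal_sup => _ [x /= x1 <-]; rewrite lee_fin.
  by rewrite (le_trans (zlam x))// -[leRHS]mulr1 ler_wpM2l.
have dual x : nrm x <= 1 -> dot z x <= lam.
  by move=> x1; rewrite -lee_fin (le_trans _ zlam)// ereal_sup_ubound//; exists x.
have lam0 : 0 <= lam by rewrite -(dot0r z) dual// nrm0.
split=> // y; have [y0|y0] := eqVneq (nrm y) 0.
  case: hnrm => _ _ /(_ _ y0) ->; rewrite dot0r mulr_ge0//.
  by rewrite nrm0.
have {}y0 : 0 < nrm y by rewrite lt0r y0 nrm_ge0.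
have := dual ((nrm y)^-1 *: y).
rewrite nrmZ dotZr ger0_norm ?invr_ge0 ?nrm_ge0// mulVf ?gt_eqF//.
by move=> /(_ (lexx _)); rewrite mulrC ler_pdivrMr.
Qed.

End Norm.

(** * Multipliers for a bound on a polyhedron *)

Lemma le0_of_bounded_multiples (R : realFieldType) (u v : R) :
  (forall t, 0 < t -> t * u <= v) -> u <= 0.
Proof.
move=> uv; rewrite leNgt; apply/negP => u0.
have t0 : 0 < (`|v| + 1) / u by rewrite divr_gt0// ltr_pwDr.
have := uv _ t0; rewrite divfK ?gt_eqF//; have := ler_norm v; lra.
Qed.

Section PolyhedralDuality.
Context {R : realType} {m p K : nat} (nrm : 'cV[R]_m -> R).
Hypothesis hnrm : is_norm nrm.
Variables (C : 'M[R]_(p, m)) (d : 'cV[R]_p) (x0 : 'cV[R]_m).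
Hypothesis x0P : polyhedron C d x0.
Variables (a : 'I_K -> 'cV[R]_m) (b : 'I_K -> R) (lam s : R).
Hypothesis lam0 : 0 <= lam.
Hypothesis majorant : forall x, polyhedron C d x ->
  exists k, dot (a k) x + b k <= s + lam * nrm (x - x0).

Let slack := d - C *m x0.
Let alpha k := dot (a k) x0 + b k.

Lemma slack_ge0 : cv_le 0 slack.
Proof. by move=> j; rewrite !mxE subr_ge0; have := x0P j; rewrite mxE. Qed.

Let floor_alpha : exists g, forall k, g <= alpha k.
Proof.
exists (- \sum_k `|alpha k|) => k; rewrite lerNl (bigD1 k)//=.
have : 0 <= \sum_(i < K | i != k) `|alpha i| by rewrite sumr_ge0.
have := ler_norm (- alpha k); rewrite normrN; lra.
Qed.

(** The set [E] below collects the differences between the epigraph of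
    [s + lam * nrm] and the hypograph of the minimum of the affine functions
    over the polyhedron, both recentred at [x0]; [majorant] says that it meets
    the vertical axis nowhere below the origin.  A linear minorant [h] of [E]
    separates the two sets.  The bound [h <= lam * nrm] follows since [h] grows
    linearly along rays. *)
Lemma affine_sandwich : exists h : 'cV[R]_m,
  (forall z, dot h z <= lam * nrm z) /\
  (forall y g, cv_le (C *m y) slack ->
     (forall k, g <= alpha k + dot (a k) y) -> g <= s + dot h y).
Proof.
have [g0 g0P] := floor_alpha.
pose E x r := exists y z g, [/\ x = z - y, cv_le (C *m y) slack,
  forall k, g <= alpha k + dot (a k) y & lam * nrm z + s - g <= r].
have cE : convex_graph E.
  move=> x r x' r' w [y [z [g [-> Cy gy rE]]]] [y' [z' [g' [-> Cy' gy' rE']]]].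
  move=> /andP[w0 w1]; have w1' : 0 <= 1 - w by lra.
  exists (w *: y + (1 - w) *: y'), (w *: z + (1 - w) *: z').
  exists (w * g + (1 - w) * g'); split.
  - by rewrite !scalerBr addrACA opprD.
  - move=> j; rewrite mulmxDr -!scalemxAr mxE [X in X + _]mxE [X in _ + X]mxE.
    have := ler_wpM2l w0 (Cy j); have := ler_wpM2l w1' (Cy' j); lra.
  - move=> k; rewrite dotDr !dotZr.
    have := ler_wpM2l w0 (gy k); have := ler_wpM2l w1' (gy' k); lra.
  - have : lam * nrm (w *: z + (1 - w) *: z') <=
           lam * (w * nrm z + (1 - w) * nrm z').
      rewrite ler_wpM2l// (le_trans (nrmD hnrm _ _))// !nrmZ//.
      by rewrite !ger0_norm.
    have := ler_wpM2l w0 rE; have := ler_wpM2l w1' rE'; lra.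
have zeroP : cv_le (C *m 0) slack by rewrite mulmx0; exact: slack_ge0.
have g0P' k : g0 <= alpha k + dot (a k) 0 by rewrite dot0r addr0.
have [||h hP] := convex_graph_minorant cE.
- move=> x; exists (lam * nrm x + s - g0), 0, x, g0.
  by rewrite subr0; split.
- move=> r [y [z [g [/esym/eqP]]]]; rewrite subr_eq0 => /eqP -> Cy gy.
  apply: le_trans; have [|k] := majorant (x := x0 + y).
    move=> j; rewrite mulmxDr mxE; have := Cy j; rewrite !mxE; lra.
  rewrite [x0 + y]addrC addrK dotDr => kP.
  by have := gy k; rewrite /alpha; lra.
exists h; split=> [z|y g Cy gy]; last first.
  (* The apex z = 0 of the norm cone gives the bound on the polyhedron. *)
  have := hP (0 - y) (lam * nrm 0 + s - g); rewrite nrm0// dotBr dot0r.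
  move=> /(_ _)/wrap[|]; last by lra.
  by exists y, 0, g; split=> //; rewrite nrm0.
(* The centre y = 0 of the polyhedron and z = t z give the bound on h. *)
rewrite -subr_le0; apply: (@le0_of_bounded_multiples _ _ (s - g0)) => t t0.
have := hP (t *: z - 0) (lam * nrm (t *: z) + s - g0).
rewrite subr0 dotZr nrmZ// (gtr0_norm t0) => /(_ _)/wrap[|]; last by lra.
by exists 0, (t *: z), g0; split; rewrite ?subr0// nrmZ// gtr0_norm.
Qed.

(** The bound by the affine function [s + h] is homogenised so that
    Farkas' lemma applies: a point [(y, (t, u))] with [t > 0] stands for the
    point [y / t] of the recentred polyhedron and a lower bound [u / t] on the
    gaps [alpha k - s + (a k - h) (y / t)], which must not be positive.  For
    [t = 0] the vector [y] is a recession direction, along which a positive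
    [u] would eventually violate the bound. *)
Lemma polyhedral_dual_certificate :
  exists (gam : 'cV[R]_p) (theta : 'cV[R]_K),
  [/\ cv_le 0 gam, cv_le 0 theta, \sum_k theta k ord0 = 1,
      \sum_k theta k ord0 * alpha k + dot gam slack <= s &
      forall y, dot gam (C *m y) - \sum_k theta k ord0 * dot (a k) y
                <= lam * nrm y].
Proof.
have [h [hlam hmaj]] := affine_sandwich.
have [g0 g0P] := floor_alpha.
pose V : lmodType R := ('cV[R]_m * (R^o * R^o))%type.
pose f (i : ('I_p + 'I_K) + 'I_1) (v : V) : R :=
  match i with
  | inl (inl j) => (C *m v.1) j ord0 - v.2.1 * slack j ord0
  | inl (inr k) =>
      v.2.2 - (dot (a k) v.1 - dot h v.1 + v.2.1 * (alpha k - s))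
  | inr _ => - v.2.1
  end.
have linf i : scalar (f i).
  move=> c [y [t u]] [y' [t' u']]; case: i => [[j|k]|j] /=.
  - by rewrite mulmxDr -scalemxAr !mxE /GRing.scale/=; ring.
  - by rewrite !dotDr !dotZr /GRing.scale/=; ring.
  - by rewrite /GRing.scale/=; ring.
have [||w w0 wP] := farkas (g := fun v : V => v.2.2 : R) linf.
- by move=> c [y [t u]] [y' [t' u']].
- move=> [y [t u]] fle /=.
  have /= t0 := fle (inr ord0).
  have /= Cy j := fle (inl (inl j)).
  have /= uy k := fle (inl (inr k)).
  have [t_gt0|t_le0] := ltP 0 t.
    suff : u / t <= 0 by rewrite pmulr_lle0// invr_gt0.
    have := hmaj (t^-1 *: y) ((u + dot h y) / t + s).
    rewrite dotZr => /(_ _ _)/wrap[||]; last by lra.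
      move=> j; rewrite -scalemxAr mxE mulrC ler_pdivrMr// mulrC.
      by have := Cy j; lra.
    move=> k; rewrite dotZr -lerBrDr ler_pdivrMr//.
    have -> : (alpha k + t^-1 * dot (a k) y - s) * t =
              dot (a k) y + t * (alpha k - s) by field; rewrite gt_eqF.
    by have := uy k; lra.
  have {t_le0}t0 : t = 0 by lra.
  subst t; apply: (@le0_of_bounded_multiples _ _ (s - g0)) => t t0'.
  have := hmaj (t *: y) (t * (u + dot h y) + g0).
  rewrite dotZr => /(_ _ _)/wrap[||]; last by lra.
    move=> j; rewrite -scalemxAr mxE; have := slack_ge0 j; rewrite [(0 : 'cV__) _ _]mxE.
    apply: le_trans; rewrite mulr_ge0_le0 ?(ltW t0')//.
    by have := Cy j; lra.
  move=> k; rewrite dotZr; have := g0P k.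
  have : t * (u + dot h y) <= t * dot (a k) y; last by lra.
  by rewrite ler_pM2l//; have := uy k; lra.
exists (\col_j w (inl (inl j))), (\col_k w (inl (inr k))).
have sum1 : \sum_k w (inl (inr k)) = 1.
  have /= := wP (0, (0, 1)); rewrite !big_sumType/= big_ord1 => sum1E.
  rewrite [RHS]sum1E oppr0 mulr0 addr0 [X in _ = X + _]big1 ?add0r; last first.
    by move=> j _; rewrite mulmx0 mxE mul0r subr0 mulr0.
  by apply: eq_bigr => k _; rewrite !dot0r mul0r subrr addr0 subr0 mulr1.
have thetaE F : \sum_k (\col_k w (inl (inr k))) k ord0 * F k =
                \sum_k w (inl (inr k)) * F k.
  by apply: eq_bigr => k _; rewrite mxE.
have gamE y : dot (\col_j w (inl (inl j))) y =
              \sum_j w (inl (inl j)) * y j ord0.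
  by rewrite dotE; apply: eq_bigr => j _; rewrite mxE.
split.
- by move=> j; rewrite !mxE.
- by move=> k; rewrite !mxE.
- by rewrite -[RHS]sum1; apply: eq_bigr => k _; rewrite mxE.
(* The multiplier of - t is the slack in the value. *)
- rewrite thetaE gamE.
  have /= := wP (0, (1, 0)); rewrite !big_sumType/= big_ord1.
  under eq_bigr do rewrite mulmx0 mxE mul1r sub0r mulrN.
  under [X in _ + X + _]eq_bigr do
    rewrite !dot0r mul1r subrr !add0r opprB mulrBr.
  rewrite sumrN sumrB -mulr_suml sum1; have := w0 (inr ord0); lra.
- move=> y; rewrite thetaE gamE.
  have /= := wP (y, (0, 0)); rewrite !big_sumType/= big_ord1.
  under eq_bigr do rewrite mul0r subr0.
  under [X in _ + X + _]eq_bigr do rewrite mul0r addr0 sub0r opprB mulrBr.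
  rewrite sumrB -mulr_suml sum1 oppr0 mulr0.
  by have := hlam (0 - y); rewrite dotBr dot0r !sub0r nrmN//; lra.
Qed.

End PolyhedralDuality.

(** * Topology and measurability of a norm *)

Section NormTopology.
Context {R : realType} {m : nat} (nrm : 'cV[R]_m -> R).
Hypothesis hnrm : is_norm nrm.

Lemma nrm_sum (I : Type) (r : seq I) (F : I -> 'cV[R]_m) :
  nrm (\sum_(i <- r) F i) <= \sum_(i <- r) nrm (F i).
Proof.
elim: r => [|i r IH]; first by rewrite !big_nil nrm0.
by rewrite !big_cons (le_trans (nrmD hnrm _ _))// lerD2l.
Qed.

Lemma nrm_dist_le x y : `|nrm x - nrm y| <= nrm (x - y).
Proof.
have := nrmD hnrm (x - y) y; have := nrmD hnrm (y - x) x.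
by rewrite !subrK (nrmB hnrm y) ler_norml; lra.
Qed.

(** Stated coordinatewise so that it bounds [nrm] by the max norm of a column
    as well as by that of its transpose, where compactness is used. *)
Lemma nrm_le_coord : exists2 M, 0 < M &
  forall (x : 'cV[R]_m) t, 0 <= t -> (forall j, `|x j ord0| <= t) -> nrm x <= M * t.
Proof.
pose M := \sum_(j < m) nrm (delta_mx j ord0).
have M0 : 0 <= M by rewrite sumr_ge0// => j _; exact: nrm_ge0.
exists (M + 1) => [|x t t0 xt]; first by rewrite ltr_wpDl.
apply: (@le_trans _ _ (M * t)); last by rewrite ler_wpM2r// lerDl.
rewrite [x in nrm x]matrix_sum_delta (le_trans (nrm_sum _ _))// mulr_suml.
apply: ler_sum => i _; rewrite big_ord1 nrmZ// mulrC ler_wpM2l//.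
exact: nrm_ge0.
Qed.

Lemma coord_le_norm n k (x : 'M[R]_(n, k)) i j : `|x i j| <= `|x|.
Proof.
by rewrite [leRHS]/Num.norm /= mx_normrE; apply/bigmax_geP; right; exists (i, j).
Qed.

Lemma lipschitz_continuous_norm n k (f : 'M[R]_(n, k) -> R) (L : R) :
  (forall x y, `|f x - f y| <= L * `|x - y|) -> continuous f.
Proof.
move=> fL x.
apply/(@cvgrPdist_lt R _ 'M[R]_(n, k) (nbhs x) (nbhs_filter x) f (f x)).
move=> e e0; near=> y.
apply: le_lt_trans (fL x y) _.
have : `|x - y| < e / (`|L| + 1).
  near: y; apply: cvgr_dist_lt; first exact: cvg_id.
  by rewrite divr_gt0// ltr_wpDl.
rewrite ltr_pdivlMr ?ltr_wpDl// => xy.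
apply: le_lt_trans xy; rewrite mulrC ler_wpM2l//.
by rewrite (le_trans (ler_norm _))// lerDl.
Unshelve. all: by end_near. Qed.

Lemma nrm_lipschitz_continuous (f : 'cV[R]_m -> R) (L : R) : 0 <= L ->
  (forall x y, `|f x - f y| <= L * nrm (x - y)) -> continuous f.
Proof.
have [M M0 nM] := nrm_le_coord; move=> L0 fL.
apply: (@lipschitz_continuous_norm _ _ _ (L * M)) => x y.
rewrite (le_trans (fL x y))// -mulrA ler_wpM2l// nM// => j.
exact: coord_le_norm.
Qed.

(** The continuous function [nrm] attains a positive minimum on the unit
    sphere of the max norm, which is compact.  With [m = 0] there is no sphere
    and every vector is null. *)
Lemma norm_le_nrm : exists2 c, 0 < c &
  forall x : 'cV[R]_m, c * `|x^T| <= nrm x.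
Proof.
have [M M0 nM] := nrm_le_coord.
pose sphere := [set v : 'rV[R]_m | `|v| = 1].
have trc : continuous (fun v : 'rV[R]_m => nrm v^T).
  apply: (@lipschitz_continuous_norm _ _ _ M) => v w.
  apply: (le_trans (nrm_dist_le _ _)); apply: nM => // j.
  by apply: le_trans (coord_le_norm _ ord0 j); rewrite !mxE.
have normc : continuous (fun v : 'rV[R]_m => `|v|).
  apply: (@lipschitz_continuous_norm _ _ _ 1) => v w.
  by rewrite mul1r ler_dist_dist.
have [S0|S0] := pselect (sphere !=set0); last first.
  exists 1 => // x; have [->|x0] := eqVneq (x^T) 0.
    by rewrite normr0 mulr0 nrm_ge0.
  case: S0; exists (`|x^T|^-1 *: x^T) => /=.
  by rewrite /sphere/= normrZ normfV normr_id mulVf// normr_eq0.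
have cS : compact sphere.
  apply: bounded_closed_compact.
    by exists 1; split => // t t1 v /= ->; exact: ltW.
  rewrite (_ : sphere = (fun v : 'rV[R]_m => `|v|) @^-1` [set x | x = 1])//.
  by apply: closed_comp => [v _|]; [exact: normc|exact: closed_eq].
have [v vS vmin] := EVT_min_rV S0 cS (continuous_subspaceT trc).
have v1 : `|v| = 1 by move: vS; rewrite inE.
exists (nrm v^T).
  rewrite lt0r nrm_ge0// andbT; apply/eqP => v0.
  case: hnrm => _ _ /(_ _ v0) /(congr1 trmx); rewrite trmxK trmx0 => v0'.
  by move: v1; rewrite v0' normr0 => /eqP; rewrite eq_sym oner_eq0.
move=> x; have [->|x0] := eqVneq (x^T) 0.
  by rewrite normr0 mulr0 nrm_ge0.
have xn0 : 0 < `|x^T| by rewrite normr_gt0.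
have := vmin (`|x^T|^-1 *: x^T).
rewrite inE /sphere/= normrZ normfV normr_id mulVf ?gt_eqF// => /(_ erefl).
rewrite linearZ/= trmxK nrmZ// normfV normr_id => h.
by rewrite mulrC -ler_pdivlMl.
Qed.

Lemma dual_norm_finite (z : 'cV[R]_m) : exists2 L, 0 <= L &
  forall x, dot z x <= L * nrm x.
Proof.
have [c c0 cP] := norm_le_nrm.
have S0 : 0 <= \sum_j `|z j ord0| by rewrite sumr_ge0.
exists ((\sum_j `|z j ord0|) / c) => [|x]; first by rewrite divr_ge0// ltW.
rewrite -mulrA (le_trans _ (ler_wpM2l S0 (_ : `|x^T| <= _)))//; last first.
  by rewrite ler_pdivlMl.
rewrite dotE mulr_suml; apply: ler_sum => j _.
rewrite (le_trans (ler_norm _))// normrM ler_wpM2l//.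
by apply: le_trans (coord_le_norm _ ord0 j); rewrite mxE.
Qed.

Lemma dual_norm_finite_abs (z : 'cV[R]_m) : exists2 L, 0 <= L &
  forall x, `|dot z x| <= L * nrm x.
Proof.
have [L L0 zL] := dual_norm_finite z; exists L => // x.
have := zL x; have := zL (0 - x); rewrite dotBr dot0r !sub0r nrmN// ler_norml; lra.
Qed.

Local Notation T := (borel_cV R m).

Lemma continuous_borel_measurable (f : 'cV[R]_m -> R) :
  continuous f -> measurable_fun setT (f : T -> R).
Proof.
move=> /continuousP cf; apply: (measurability _ (RGenOpens.measurableE R)).
move=> _ [_ [a [b ->] <-]]; rewrite setTI; apply: sub_sigma_algebra.
exact/cf/interval_open.
Qed.

Lemma nrm_lipschitz_measurable (f : 'cV[R]_m -> R) (L : R) : 0 <= L ->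
  (forall x y, `|f x - f y| <= L * nrm (x - y)) ->
  measurable_fun setT (f : T -> R).
Proof.
by move=> L0 /(nrm_lipschitz_continuous L0); exact: continuous_borel_measurable.
Qed.

Lemma measurable_nrm_subr (q : 'cV[R]_m) :
  measurable_fun setT ((fun x => nrm (x - q)) : T -> R).
Proof.
apply: (@nrm_lipschitz_measurable _ 1) => // x y.
by rewrite mul1r (le_trans (nrm_dist_le _ _))// opprB addrA subrK.
Qed.

Lemma measurable_polyhedron p (C : 'M[R]_(p, m)) (d : 'cV[R]_p) :
  measurable (polyhedron C d : set T).
Proof.
have -> : polyhedron C d = \bigcap_(j in [set: 'I_p])
    (setT `&` (dot (row j C)^T) @^-1` `]-oo, d j ord0]%classic).
  have rowE j x : (C *m x) j ord0 = dot (row j C)^T x.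
    by rewrite dotE mxE; apply: eq_bigr => i _; rewrite !mxE.
  apply/seteqP; split => [x Px j _|x Px j]; last first.
    by have [_] := Px j I; rewrite /= in_itv/= rowE.
  by split => //; rewrite /= in_itv/= -rowE; exact: Px.
apply: fin_bigcap_measurable => // j _.
have [L L0 zL] := dual_norm_finite_abs (row j C)^T.
apply: (@nrm_lipschitz_measurable _ L) => // x y.
by rewrite -dotBr; exact: zL.
Qed.

Lemma rational_points_dense (x : 'cV[R]_m) (e : R) : 0 < e ->
  exists q : 'cV[rat]_m, nrm (x - map_mx ratr q) < e.
Proof.
move=> e0; have [M M0 nM] := nrm_le_coord.
pose r := e / 2 / M; have r0 : 0 < r by rewrite !divr_gt0.
have /choice[q qP] j : exists t : rat, `|x j ord0 - ratr t| <= r.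
  have /rat_in_itvoo[t] : x j ord0 < x j ord0 + r by rewrite ltrDl.
  by rewrite in_itv/= => /andP[? ?]; exists t; rewrite ler_norml; lra.
exists (\col_j q j); apply: (@le_lt_trans _ _ (M * r)).
  by apply: nM => [|j]; [exact: ltW|rewrite !mxE].
by rewrite mulrC divfK ?gt_eqF//; lra.
Qed.

(** The product sigma-algebra is generated by rectangles, so the continuity of
    the map does not give its measurability at once.  But [nrm (x - y) < r] holds iff
    [nrm (x - q) + nrm (y - q) < r] for some rational [q], which is a countable
    union of measurable sets. *)
Lemma measurable_distance :
  measurable_fun setT ((fun z => nrm (z.1 - z.2)) : T * T -> R).
Proof.
apply: (measurability _ (RGenInftyO.measurableE R)).
move=> _ [_ [r ->] <-]; rewrite setTI.
pose f (q : 'cV[rat]_m) (z : T * T) : R :=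
  nrm (z.1 - map_mx ratr q) + nrm (z.2 - map_mx ratr q).
have -> : (fun z : T * T => nrm (z.1 - z.2)) @^-1` `]-oo, r[%classic =
    \bigcup_(q in setT) (setT `&` f q @^-1` `]-oo, r[%classic).
  apply/seteqP; split => [[x y]|[x y] [q _ [_]]] /=; rewrite !in_itv/=.
    move=> xyr; have e0 : 0 < (r - nrm (x - y)) / 2 by lra.
    have [q qP] := rational_points_dense x e0.
    exists q => //; split => //; rewrite /= in_itv/= /f/=.
    have := nrmD hnrm (y - x) (x - map_mx ratr q).
    by rewrite addrA subrK (nrmB hnrm y x); lra.
  apply: le_lt_trans; rewrite /f/= (nrmB hnrm y).
  by apply: le_trans (nrmD hnrm _ _); rewrite addrA subrK.
apply: countable_bigcupT_measurable => [|q]; first exact: countableP.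
have mf : measurable_fun setT (f q).
  by apply: measurable_funD; [
    exact: (measurableT_comp (measurable_nrm_subr _) measurable_fst)|
    exact: (measurableT_comp (measurable_nrm_subr _) measurable_snd)].
by apply: mf => //; exact: measurable_itv.
Qed.

End NormTopology.

(** * Integration lemmas *)

Section Integrals.
Local Open Scope ereal_scope.
Context d (T : measurableType d) (R : realType).
Implicit Types (mu : {measure set T -> \bar R}) (D : set T).

Lemma measurable_EFin_restrict D (f : T -> R) : measurable_fun setT f ->
  measurable_fun D (fun x : T => (f x)%:E).
Proof. by move=> mf; apply: measurable_funTS; exact/measurable_EFinP. Qed.

(** Holds without integrability: the positive and negative parts compare
    separately, and subtraction of extended reals is monotone with the
    convention [+oo - +oo = -oo]. *)
Lemma le_integral_measurable mu D (f g : T -> R) : measurable D ->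
  measurable_fun setT f -> measurable_fun setT g ->
  (forall x, D x -> (f x <= g x)%R) ->
  \int[mu]_(x in D) (f x)%:E <= \int[mu]_(x in D) (g x)%:E.
Proof.
move=> mD mf mg fg.
have fg' : {in D, forall x, (f x)%:E <= (g x)%:E}.
  by move=> x; rewrite inE lee_fin; exact: fg.
rewrite integralE [leRHS]integralE; apply: leeB; apply: ge0_le_integral => //.
- exact/measurable_funepos/measurable_EFin_restrict.
- exact/measurable_funepos/measurable_EFin_restrict.
- by move=> x /mem_set; exact: funepos_le.
- exact/measurable_funeneg/measurable_EFin_restrict.
- exact/measurable_funeneg/measurable_EFin_restrict.
- by move=> x /mem_set; exact: funeneg_le.
Qed.

Lemma integral_funrposneg mu D (f : T -> R) :
  \int[mu]_(x in D) (f x)%:E =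
  \int[mu]_(x in D) ((f^\+)%R x)%:E - \int[mu]_(x in D) ((f^\-)%R x)%:E.
Proof.
rewrite integralE; congr (_ - _); apply: eq_integral => x _.
  by rewrite funeposE -EFin_max.
by rewrite funenegE -EFinN -EFin_max.
Qed.

Lemma integral_concentrated mu D (f : T -> R) :
  measurable D -> mu (~` D) = 0 -> measurable_fun setT f ->
  \int[mu]_x (f x)%:E = \int[mu]_(x in D) (f x)%:E.
Proof.
move=> mD muD mf; rewrite integral_funrposneg [RHS]integral_funrposneg.
have DE : setT `\` ~` D = D by rewrite setTD setCK.
congr (_ - _); rewrite (@ge0_negligible_integral _ _ _ _ _ (~` D)) ?DE//;
  do ?[exact: measurableC|
  exact/measurable_EFin_restrict/measurable_funrpos|
  exact/measurable_EFin_restrict/measurable_funrneg|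
  by move=> x _; rewrite lee_fin].
Qed.

End Integrals.

(** Like change of variables along [phi], but for a measure [nu] that agrees
    with the image measure only on measurable sets, as marginals of couplings
    do, and without integrability. *)
Lemma integral_marginal d1 d2 (X : measurableType d1) (Y : measurableType d2)
    (R : realType) (phi : X -> Y) (mu : {measure set X -> \bar R})
    (nu : {measure set Y -> \bar R}) (f : Y -> R) :
  measurable_fun setT phi -> measurable_fun setT f ->
  (forall A, measurable A -> pushforward mu phi A = nu A) ->
  (\int[nu]_y (f y)%:E = \int[mu]_x (f (phi x))%:E)%E.
Proof.
move=> mphi mf muE.
have pos (g : Y -> R) : measurable_fun setT g -> (forall y, 0 <= g y) ->
    (\int[nu]_y (g y)%:E = \int[mu]_x (g (phi x))%:E)%E.
  move=> mg g0.
  rewrite -(eq_measure_integral _ (m1 := pushforward mu phi)); last first.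
    by move=> A mA _; exact: muE.
  rewrite ge0_integral_pushforward//; last by move=> y _; rewrite lee_fin.
  exact/measurable_EFinP.
rewrite integral_funrposneg [RHS]integral_funrposneg.
rewrite !pos//; [exact: measurable_funrneg|exact: measurable_funrpos].
Qed.

(** * Mixtures of empirical measures *)

Section EmpiricalMixture.
Context d (T : measurableType d) (R : realType) (N : nat).
Implicit Types (x y : 'I_N -> T).

Lemma ge0_integral_empirical x (f : T -> R) :
  measurable_fun setT f -> (forall t, 0 <= f t) ->
  (\int[empirical R x]_t (f t)%:E = (N%:R^-1 * \sum_i f (x i))%:E)%E.
Proof.
move=> mf f0; have N0 : 0 <= (N%:R : R)^-1 by rewrite invr_ge0.
pose D n : {measure set T -> \bar R} :=
  if insub n is Some i then \d_(x i) else mzero.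
rewrite (eq_measure_integral (mscale (NngNum N0) (msum D N))); last first.
  move=> A mA _; rewrite /mscale /msum /empirical /=; congr (_ * _)%E.
  by apply: eq_bigr => i _; rewrite /D valK.
have mf' := measurable_EFin_restrict (D := setT) mf.
rewrite ge0_integral_mscale//; last by move=> t _; rewrite lee_fin.
rewrite ge0_integral_measure_sum//; last by move=> t _; rewrite lee_fin.
rewrite EFinM -sumEFin; congr (_ * _)%E; apply: eq_bigr => i _.
by rewrite /D valK integral_dirac// diracT mul1e.
Qed.

(** The mixture [mu] already has mass one; [mnormalize] only equips it with its
    structure of probability measure, and the Dirac mass is the value that it
    would take on a null measure. *)
Lemma empirical_mixture x y (w : R) : (0 < N)%N -> 0 <= w <= 1 ->
  exists Q : probability T R,
  (forall A, Q A = w%:E * empirical R x A + (1 - w)%:E * empirical R y A)%E /\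
  (forall f : T -> R, measurable_fun setT f ->
    (\int[Q]_t (f t)%:E =
     (N%:R^-1 * \sum_i (w * f (x i) + (1 - w) * f (y i)))%:E)%E).
Proof.
move=> hN /andP[w0 w1]; have w1' : 0 <= 1 - w by rewrite subr_ge0.
pose mu : {measure set T -> \bar R} := measure_add
  (mscale (NngNum w0) (empirical R x)) (mscale (NngNum w1') (empirical R y)).
have muE A :
    (mu A = w%:E * empirical R x A + (1 - w)%:E * empirical R y A)%E.
  exact: measure_addE.
have empT (z : 'I_N -> T) : empirical R z [set: T] = 1%E.
  rewrite /empirical; under eq_bigr do rewrite diracT.
  rewrite sumEFin sumr_const card_ord -EFinM mulVf//.
  by rewrite pnatr_eq0 -lt0n.
have muT : mu setT = 1%E.
  by rewrite muE !empT !mule1 -EFinD addrC subrK.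
pose Q : probability T R := mnormalize mu \d_(x (Ordinal hN)).
have QE A : Q A = mu A.
  by rewrite /Q/= /mnormalize muT/= onee_eq0/= invr1 mule1.
exists Q; split => [A|f mf]; first by rewrite QE muE.
have pos (g : T -> R) : measurable_fun setT g -> (forall t, 0 <= g t) ->
    (\int[Q]_t (g t)%:E =
     (N%:R^-1 * \sum_i (w * g (x i) + (1 - w) * g (y i)))%:E)%E.
  move=> mg g0; have mg' := measurable_EFin_restrict (D := setT) mg.
  rewrite (eq_measure_integral mu); last by move=> A _ _; exact: QE.
  rewrite ge0_integral_measure_add//; last by move=> t _; rewrite lee_fin.
  rewrite !ge0_integral_mscale//; [|by move=> t _; rewrite lee_fin..].
  rewrite !ge0_integral_empirical//= -!EFinM -EFinD big_split/= -!mulr_sumr.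
  by congr EFin; ring.
rewrite integral_funrposneg.
rewrite !pos//; [|exact: measurable_funrneg|exact: measurable_funrpos].
rewrite -EFinB -mulrBr -sumrB; congr (_ * _)%:E; apply: eq_bigr => i _.
have fE t : f t = f^\+ t - f^\- t by rewrite -[in LHS](funrposBneg f).
by rewrite !fE; ring.
Qed.

Lemma integral_empirical x (f : T -> R) : (0 < N)%N -> measurable_fun setT f ->
  (\int[empirical R x]_t (f t)%:E = (N%:R^-1 * \sum_i f (x i))%:E)%E.
Proof.
move=> hN mf; have w01 : 0 <= (1 : R) <= 1 by rewrite ler01 lexx.
have [Q [QE Qint]] := empirical_mixture x x hN w01.
transitivity (\int[Q]_t (f t)%:E)%E.
  apply: eq_measure_integral => A _ _.
  by rewrite [RHS]QE subrr mul1e mul0e adde0.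
by rewrite Qint//; under eq_bigr do rewrite subrr mul1r mul0r addr0.
Qed.

End EmpiricalMixture.

(** * Semi-dual form of the worst-case expectation *)

(** A bound on every sum of choices from the sets [G i] passes to the sum of
    their suprema; fixing all choices but one bounds each [G i]. *)
Lemma sum_of_suprema (R : realType) (I : finType) (G : I -> set R) (B : R) :
  (forall i, G i !=set0) ->
  (forall y, (forall i, G i (y i)) -> \sum_i y i <= B) ->
  exists2 s : I -> R, forall i y, G i y -> y <= s i & \sum_i s i <= B.
Proof.
move=> G0 GB; have /choice[y0 y0G] i : exists y, G i y by exact: G0.
have supG i : has_sup (G i).
  split; first exact: G0.
  exists (B - \sum_(j | j != i) y0 j) => y Gy.
  have := GB (fun j => if j == i then y else y0 j).
  rewrite (bigD1 i)//= eqxx lerBrDr.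
  under eq_bigr => j ji do rewrite (negPf ji).
  by apply => j; case: eqP => [->|].
exists (fun i => sup (G i)) => [i y Gy|]; first exact: sup_upper_bound.
apply/ler_addgt0Pr => e e0.
pose r := e / (#|I|%:R + 1); have I0 : 0 < #|I|%:R + 1 :> R by rewrite ltr_wpDl.
have r0 : 0 < r by rewrite divr_gt0.
have /choice[y yG] i : exists y, G i y /\ sup (G i) - r < y.
  by have [y Gy ry] := sup_adherent r0 (supG i); exists y.
have : \sum_i (sup (G i) - r) <= B.
  apply: le_trans (GB y _); last by move=> i; case: (yG i).
  by apply: ler_sum => i _; case: (yG i) => _ /ltW.
rewrite sumrB sumr_const -mulr_natr => h.
have : r * #|I|%:R <= e.
  rewrite /r mulrAC ler_pdivrMr// ler_wpM2l//; [exact: ltW|by rewrite lerDl].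
by lra.
Qed.

Lemma empirical_preimage d1 d2 (X : measurableType d1) (Y : measurableType d2)
    (R : realType) N (x : 'I_N -> X) (phi : X -> Y) (A : set Y) :
  empirical R x (phi @^-1` A) = empirical R (phi \o x) A.
Proof.
rewrite /empirical; congr (_ * _)%E; apply: eq_bigr => i _. 

Qed.

Lemma empirical_carrier d (T : measurableType d) (R : realType) N
    (x : 'I_N -> T) (A : set T) : (0 < N)%N -> (forall i, A (x i)) ->
  empirical R x A = 1%E.
Proof.
move=> hN Ax; rewrite /empirical; under eq_bigr do rewrite diracE mem_set//.
by rewrite sumEFin sumr_const card_ord -EFinM mulVf// pnatr_eq0 -lt0n.
Qed.

Section SemiDual.
Context {R : realType} {m N : nat} (nrm : 'cV[R]_m -> R).
Hypotheses (hnrm : is_norm nrm) (hN : (0 < N)%N).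
Local Notation T := (borel_cV R m).
Variable Xi : set 'cV[R]_m.
Hypothesis mXi : measurable (Xi : set T).
Variable xi : 'I_N -> 'cV[R]_m.
Hypothesis xiP : forall i, Xi (xi i).
Variables (ell : 'cV[R]_m -> R) (L : R).
Hypotheses (L0 : 0 <= L)
  (ell_lip : forall x y, `|ell x - ell y| <= L * nrm (x - y)).
Variable eps : R.
Hypothesis eps0 : 0 <= eps.

Definition semi_dual_feasible (lam : R) (s : 'I_N -> R) :=
  0 <= lam /\ forall i x, Xi x -> ell x <= s i + lam * nrm (x - xi i).

Local Notation PN := (empirical R (xi : 'I_N -> T)).
Local Notation V := (worst_case_expectation nrm Xi eps xi ell).

Let mell : measurable_fun setT (ell : T -> R).
Proof. exact: nrm_lipschitz_measurable L0 ell_lip. Qed.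

Let mdist := measurable_distance hnrm.

(** The cost of a coupling is integrated over [Xi * Xi] only; this makes that
    restriction harmless. *)
Lemma coupling_concentrated (mu nu : {measure set T -> \bar R})
    (Pi : probability (T * T)%type R) :
  couplings mu nu Pi -> mu (~` Xi) = 0%E -> nu (~` Xi) = 0%E ->
  Pi (~` (Xi `*` Xi)) = 0%E.
Proof.
move=> cPi mu0 nu0.
have mC : measurable (~` (Xi : set T)) by exact: measurableC.
have [fE sE] := cPi _ mC.
have mf : measurable ((fst : T * T -> T) @^-1` (~` Xi)).
  by rewrite -[X in measurable X]setTI; exact: measurable_fst.
have ms : measurable ((snd : T * T -> T) @^-1` (~` Xi)).
  by rewrite -[X in measurable X]setTI; exact: measurable_snd.
apply: (@subset_measure0 _ _ _ Pi _
   ((fst : T * T -> T) @^-1` (~` Xi) `|` (snd : T * T -> T) @^-1` (~` Xi))).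
- by apply: measurableC; exact: measurableX.
- exact: measurableU.
- move=> [x y] /= /not_andP[]; by [left|right].
- apply/eqP; rewrite eq_le measure_ge0 andbT.
  apply: (@le_trans _ _ (mu (~` Xi) + nu (~` Xi))%E).
    by rewrite -fE -sE; exact: measureU2.
  by rewrite mu0 nu0 adde0.
Qed.

(** The infimum in the transport distance need not be attained, so a
    coupling of cost below [eps + del] is used, with [lam * del <= e]. *)
Lemma semi_dual_weak lam s (Q : probability T R) :
  semi_dual_feasible lam s ->
  wasserstein_ball nrm Xi eps PN Q ->
  ('E_Q[ell] <= (lam * eps + N%:R^-1 * \sum_i s i)%:E)%E.
Proof.
move=> [lam0 feas] [[QXi _] Weps].
pose term i (x : 'cV[R]_m) := s i + lam * nrm (x - xi i).
pose i0 := Ordinal hN.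
(* The term of the index i0 is the default only because the minimum needs one. *)
pose S (x : 'cV[R]_m) := \big[Order.min/term i0 x]_i term i x.
have mS : measurable_fun setT (S : T -> R).
  have mterm i : measurable_fun setT (term i : T -> R).
    apply: measurable_funD; first exact: measurable_cst.
    by apply: measurable_funM => //; exact: measurable_nrm_subr.
  rewrite /S; elim: (index_enum _) => [|i r IH].
    by under eq_fun do rewrite big_nil; exact: mterm.
  by under eq_fun do rewrite big_cons; exact: measurable_minr.
have S_xi i : S (xi i) <= s i.
  rewrite (le_trans (bigmin_le _ i _))// /term subrr nrm0// mulr0 addr0.
  exact: lexx.
have Sell x y : Xi y -> ell y <= S x + lam * nrm (x - y).
  move=> Xy; rewrite -lerBlDr.
  have key i : ell y - lam * nrm (x - y) <= term i x.
    have := feas i y Xy; have := nrmD hnrm (y - x) (x - xi i).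
    rewrite addrA subrK (nrmB hnrm y x) /term => tri.
    by have := ler_wpM2l lam0 tri; lra.
  by apply/bigmin_geP; split.
apply/lee_addgt0Pr => e e0.
pose del := e / (lam + 1); have lam1 : 0 < lam + 1 by rewrite ltr_wpDl.
have del0 : 0 < del by rewrite divr_gt0.
have : (wasserstein nrm Xi PN Q < (eps + del)%:E)%E.
  by rewrite (le_lt_trans Weps)// lte_fin ltrDl.
move=> /ereal_inf_lt[_ [Pi cPi <-]] cost_lt.
set D := Xi `*` Xi in cost_lt.
have mD : measurable (D : set (T * T)) by exact: measurableX.
have PiD : Pi (~` D) = 0%E.
  apply: coupling_concentrated cPi _ _.
    rewrite /= /empirical big1 ?mule0// => i _.
    by rewrite diracE memNset//=; apply; exact: xiP.
  by apply: etrans (probability_setC Q mXi) _; rewrite QXi subee.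
have mfst : measurable_fun setT (fst : T * T -> T) by exact: measurable_fst.
have msnd : measurable_fun setT (snd : T * T -> T) by exact: measurable_snd.
have mell2 : measurable_fun setT (fun z : T * T => ell z.2).
  exact: measurableT_comp mell msnd.
have mS1 : measurable_fun setT (fun z : T * T => S z.1).
  exact: measurableT_comp mS mfst.
have mcost : measurable_fun setT (fun z : T * T => lam * nrm (z.1 - z.2)).
  by apply: measurable_funM => //; exact: mdist.
rewrite unlock (integral_marginal (mu := Pi) msnd mell); last first.
  by move=> A mA; case: (cPi A mA).
rewrite (integral_concentrated mD PiD mell2).
have mSc : measurable_fun setT (fun z : T * T => S z.1 + lam * nrm (z.1 - z.2)).
  exact: measurable_funD.
have le_int := le_integral_measurable Pi mD mell2 mSc.
apply: le_trans (le_int _) _; first by move=> [x y] [_ Xy]; exact: Sell.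
have costE : (\int[Pi]_(z in D) (lam * nrm (z.1 - z.2))%:E =
    lam%:E * \int[Pi]_(z in D) (nrm (z.1 - z.2))%:E)%E.
  under eq_integral do rewrite EFinM.
  rewrite ge0_integralZl_EFin//; last exact: measurable_EFin_restrict.
  by move=> z _; rewrite lee_fin nrm_ge0.
have cost_ge0 : (0 <= \int[Pi]_(z in D) (nrm (z.1 - z.2))%:E)%E.
  by apply: integral_ge0 => z _; rewrite lee_fin nrm_ge0.
have [c cE] : exists c, (\int[Pi]_(z in D) (nrm (z.1 - z.2))%:E = c%:E)%E.
  exists (fine (\int[Pi]_(z in D) (nrm (z.1 - z.2))%:E)%E).
  by rewrite fineK// ge0_fin_numE// (lt_trans cost_lt)// ltry.
have intcost : Pi.-integrable D (fun z => (lam * nrm (z.1 - z.2))%:E).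
  apply/integrableP; split; first exact: measurable_EFin_restrict.
  under eq_integral.
    move=> z _; rewrite gee0_abs ?lee_fin ?mulr_ge0 ?nrm_ge0//; over.
  by rewrite costE cE -EFinM ltry.
have intS : Pi.-integrable D (fun z => (S z.1)%:E).
  apply: (@integrableS _ _ _ _ setT) => //.
  apply/integrableP; split; first exact: measurable_EFin_restrict.
  under eq_integral do rewrite abse_EFin.
  have mSn : measurable_fun setT ((fun x => `|S x|) : T -> R).
    exact: measurableT_comp.
  rewrite -(integral_marginal (nu := PN) mfst mSn); last first.
    by move=> A mA; case: (cPi A mA).
  by rewrite integral_empirical// ltry.
under eq_integral do rewrite EFinD.
rewrite integralD// costE cE -(integral_concentrated mD PiD mS1).
rewrite -(integral_marginal (nu := PN) mfst mS); last first.
  by move=> A mA; case: (cPi A mA).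
rewrite integral_empirical// -EFinM -!EFinD lee_fin.
have c_le : lam * c <= lam * (eps + del).
  by rewrite ler_wpM2l// -lee_fin -cE ltW.
have sum_le : N%:R^-1 * \sum_i S (xi i) <= N%:R^-1 * \sum_i s i.
  by rewrite ler_wpM2l ?invr_ge0// ler_sum.
have : lam * del <= e.
  by rewrite /del mulrCA -[leRHS]mulr1 ler_pM2l// ler_pdivrMr// mul1r lerDl.
by lra.
Qed.

(** Transport cost and mean loss when every data point [xi i] is moved to
    [z i]. *)
Let cost (z : 'I_N -> 'cV[R]_m) := N%:R^-1 * \sum_i nrm (xi i - z i).
Let value (z : 'I_N -> 'cV[R]_m) := N%:R^-1 * \sum_i ell (z i).

(** The law is a mixture of the empirical measures of [z] and [z'], and the
    same mixture of the empirical measures of the pairs [(xi i, z i)] and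
    [(xi i, z' i)] couples it with the data at the stated cost. *)
Lemma mixture_value (z z' : 'I_N -> 'cV[R]_m) (w : R) :
  (forall i, Xi (z i)) -> (forall i, Xi (z' i)) -> 0 <= w <= 1 ->
  w * cost z + (1 - w) * cost z' <= eps ->
  ((w * value z + (1 - w) * value z')%:E <= V)%E.
Proof.
move=> Xz Xz' w01 cost_le.
have [Q [QE Qint]] :=
  empirical_mixture (z : 'I_N -> T) (z' : 'I_N -> T) hN w01.
have [Pi [PiE Piint]] := empirical_mixture
  ((fun i => (xi i, z i)) : 'I_N -> T * T) (fun i => (xi i, z' i)) hN w01.
have mixE (F G : 'I_N -> R) :
    N%:R^-1 * \sum_i (w * F i + (1 - w) * G i) =
    w * (N%:R^-1 * \sum_i F i) + (1 - w) * (N%:R^-1 * \sum_i G i).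
  by rewrite big_split/= -!mulr_sumr; ring.
have cPi : couplings PN Q Pi.
  move=> A mA; split; apply: etrans (PiE _) _.
    rewrite (empirical_preimage R _ fst) (empirical_preimage R _ fst).
    rewrite -ge0_muleDl ?lee_fin//; [|by lra..].
    by rewrite -EFinD addrC subrK mul1e.
  rewrite (empirical_preimage R _ snd) (empirical_preimage R _ snd).
  by apply: esym; exact: QE.
apply: ereal_sup_ubound; exists Q; last first.
  by rewrite unlock Qint// mixE.
split.
  split; first by rewrite QE !empirical_carrier// !mule1 -EFinD addrC subrK.
  rewrite unlock Qint ?ltry//; apply: (@nrm_lipschitz_measurable _ _ _ hnrm _ 1) => // x y.
  by rewrite mul1r nrm_dist_le.
apply: ereal_inf_le; exists (\int[Pi]_(t in Xi `*` Xi) (nrm (t.1 - t.2))%:E)%E.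
  by exists Pi.
apply: (@le_trans _ _ (\int[Pi]_t (nrm (t.1 - t.2))%:E)%E).
  apply: ge0_subset_integral => //.
  - exact: measurableX.
  - exact/measurable_EFinP.
  - by move=> t _; rewrite lee_fin nrm_ge0.
by rewrite Piint//= mixE lee_fin.
Qed.

(** A Lagrange multiplier for the radius.  For [eps > 0], [plane_separation] is
    applied to the pairs (cost excess over [eps], loss deficit below [v]); the
    data themselves lie strictly to the left of the axis.  Larger costs are
    allowed in [S] so that the slope has the right sign. *)
Lemma penalty_exists (v : R) : V = v%:E ->
  exists2 lam, 0 <= lam & forall z, (forall i, Xi (z i)) ->
    value z - lam * cost z <= v - lam * eps.
Proof.
move=> VE; have w1 : 0 <= (1 : R) <= 1 by rewrite ler01 lexx.
have cost_xi : cost xi = 0.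
  by rewrite /cost big1 ?mulr0// => i _; rewrite subrr nrm0.
have value_xi : value xi <= v.
  rewrite -lee_fin -VE; have := @mixture_value xi xi 1 xiP xiP w1.
  by rewrite cost_xi subrr !mul1r !mul0r !addr0; apply.
have [e0|e_gt0] : eps = 0 \/ 0 < eps.
  by move: eps0; rewrite le_eqVlt => /orP[/eqP <-|]; [left|right].
  exists L => // z Xz; rewrite e0 mulr0 subr0 (le_trans _ value_xi)//.
  rewrite lerBlDr /value /cost mulrCA -mulrDr ler_wpM2l ?invr_ge0//.
  rewrite mulr_sumr -big_split/= ler_sum// => i _.
  have := ell_lip (z i) (xi i); rewrite (nrmB hnrm) ler_norml; lra.
pose S t r := exists z, [/\ forall i, Xi (z i), cost z - eps <= t & r = v - value z].
have [||t r t' r' w [z [Xz zt ->]] [z' [Xz' zt' ->]] w01 tt'|c cP] :=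
    @plane_separation _ S.
- by exists (- eps), (v - value xi); split; [exists xi; rewrite cost_xi; split => //|]; lra.
- by exists 1, (v - value xi); split => //; exists xi; rewrite cost_xi; split => //; lra.
- have [w0 w1'] := andP w01.
  have cw : w * cost z + (1 - w) * cost z' <= eps.
    have w1n : 0 <= 1 - w by lra.
    have := ler_wpM2l w0 zt; have := ler_wpM2l w1n zt'; lra.
  have := mixture_value Xz Xz' w01 cw; rewrite VE lee_fin; lra.
exists (- c).
  rewrite oppr_ge0; apply: (@le0_of_bounded_multiples _ _ (v - value xi)) => t t0.
  by rewrite mulrC; apply: cP; exists xi; rewrite cost_xi; split => //; lra.
move=> z Xz; have : c * (cost z - eps) <= v - value z; last by lra.
by apply: cP; exists z; split.
Qed.

Lemma semi_dual_strong (v : R) : V = v%:E ->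
  exists lam s, semi_dual_feasible lam s /\
    lam * eps + N%:R^-1 * \sum_i s i <= v.
Proof.
move=> /penalty_exists[lam lam0 lamP].
have N0 : 0 < N%:R :> R by rewrite ltr0n.
pose G i := [set y | exists2 x, Xi x & y = ell x - lam * nrm (x - xi i)].
have [||s sP sum_s] := @sum_of_suprema _ _ G (N%:R * (v - lam * eps)).
- by move=> i; exists (ell (xi i) - lam * nrm (xi i - xi i)), (xi i).
- move=> y yG.
  have /choice[z zP] i : exists x, Xi x /\ y i = ell x - lam * nrm (x - xi i).
    by have [x Xx ->] := yG i; exists x.
  rewrite -ler_pdivrMl//; apply: le_trans (lamP z _); last by move=> i; case: (zP i).
  rewrite /value /cost mulrCA -mulrBr ler_wpM2l ?invr_ge0//.
  rewrite mulr_sumr -sumrB ler_sum// => i _.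
  by case: (zP i) => _ ->; rewrite (nrmB hnrm).
exists lam, s; split; last first.
  by rewrite -lerBrDl mulrC ler_pdivrMr// mulrC.
split => // i x Xx; rewrite -lerBlDr; apply: sP; by exists x.
Qed.

(** If the worst case is infinite, weak duality already makes it the infimum,
    so the strong half only has to treat a finite value. *)
Theorem worst_case_semi_dual :
  V = ereal_inf [set v : \bar R | exists lam s, semi_dual_feasible lam s /\
                   v = (lam * eps + N%:R^-1 * \sum_i s i)%:E].
Proof.
apply/eqP; rewrite eq_le; apply/andP; split.
  apply: le_ereal_inf_tmp => _ [lam [s [feas ->]]].
  apply: ge_ereal_sup => _ [Q Qball <-]; exact: semi_dual_weak.
have V_gt : ((value xi)%:E <= V)%E.
  have w1 : 0 <= (1 : R) <= 1 by rewrite ler01 lexx.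
  have := @mixture_value xi xi 1 xiP xiP w1.
  rewrite subrr !mul1r !mul0r !addr0; apply.
  by rewrite /cost big1 ?mulr0// => i _; rewrite subrr nrm0.
case VE : V V_gt => [v||] // _; last by rewrite leey.
have [lam [s [feas sv]]] := semi_dual_strong VE.
apply: ereal_inf_le; exists (lam * eps + N%:R^-1 * \sum_i s i)%:E.
  by exists lam, s.
by rewrite lee_fin.
Qed.

End SemiDual.

(** * Piecewise affine losses *)

Section PiecewiseAffine.
Context {R : realType} {m p K : nat} (nrm : 'cV[R]_m -> R).
Hypothesis hnrm : is_norm nrm.
Variables (C : 'M[R]_(p, m)) (d : 'cV[R]_p).

(** The identity behind it is
    [a x = a x0 + (C^T gam - a) (x0 - x) - gam (C x0) + gam (C x)], where
    [gam (C x) <= gam d] on the polyhedron. *)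
Lemma certificate_sound (x0 : 'cV[R]_m) (a : 'cV[R]_m) (b lam s : R) gam :
  b + dot a x0 + dot gam (d - C *m x0) <= s ->
  (dual_norm nrm (C^T *m gam - a) <= lam%:E)%E -> cv_le 0 gam ->
  forall x, polyhedron C d x -> dot a x + b <= s + lam * nrm (x - x0).
Proof.
move=> bs /(dual_norm_leP hnrm)[_ dual] gam0 x Px.
have := dual (x0 - x); rewrite dotBl dot_trmx mulmxBr !dotBr (nrmB hnrm x).
have : 0 <= dot gam (d - C *m x).
  by apply: dot_ge0 => // j; have := Px j; rewrite !mxE subr_ge0.
by rewrite dotBr; move: bs; rewrite dotBr; lra.
Qed.

Variables (a : 'I_K -> 'cV[R]_m) (b : 'I_K -> R).

Lemma affine_family_lipschitz : exists2 L, 0 <= L &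
  forall k x y, `|(dot (a k) x + b k) - (dot (a k) y + b k)| <= L * nrm (x - y).
Proof.
have /choice[L LP] k : exists L, 0 <= L /\
    forall x, `|dot (a k) x| <= L * nrm x.
  by have [L L0 LP] := dual_norm_finite_abs hnrm (a k); exists L.
have sum0 (P : pred 'I_K) : 0 <= \sum_(k | P k) L k.
  by rewrite sumr_ge0// => k _; case: (LP k).
exists (\sum_k L k) => // k x y.
rewrite opprD addrACA subrr addr0 -dotBr; have [_ /(_ (x - y)) h] := LP k.
rewrite (le_trans h)// ler_wpM2r ?nrm_ge0// (bigD1 k)//= lerDl.
exact: sum0.
Qed.

Lemma max_attained (ell : 'cV[R]_m -> R) (x : 'cV[R]_m) : (0 < K)%N ->
  (ell x)%:E = \big[maxe/-oo%E]_(k < K) (dot (a k) x + b k)%:E ->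
  (forall k, dot (a k) x + b k <= ell x) /\
  (exists k, ell x = dot (a k) x + b k).
Proof.
move=> hK ellE; split => [k|].
  by rewrite -lee_fin ellE; exact: le_bigmax.
have [k _ kE] := @eq_bigmax _ _ _ -oo%E (Ordinal hK) xpredT
  (fun k => (dot (a k) x + b k)%:E) isT (fun k _ => leNye _).
by exists k; apply: EFin_inj; rewrite ellE kE.
Qed.

Lemma min_attained (ell : 'cV[R]_m -> R) (x : 'cV[R]_m) : (0 < K)%N ->
  (ell x)%:E = \big[mine/+oo%E]_(k < K) (dot (a k) x + b k)%:E ->
  (forall k, ell x <= dot (a k) x + b k) /\
  (exists k, ell x = dot (a k) x + b k).
Proof.
move=> hK ellE; split => [k|].
  by rewrite -lee_fin ellE; exact: bigmin_le.
have [k _ kE] := @eq_bigmin _ _ _ +oo%E (Ordinal hK) xpredT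
  (fun k => (dot (a k) x + b k)%:E) isT (fun k _ => leey _).
by exists k; apply: EFin_inj; rewrite ellE kE.
Qed.

End PiecewiseAffine.

Theorem corollary5p1 (R : realType) (m p N K : nat)
    (nrm : 'cV[R]_m -> R) (hnrm : is_norm nrm)
    (C : 'M[R]_(p, m)) (d : 'cV[R]_p)
    (hN : (0 < N)%N) (hK : (0 < K)%N)
    (xi : 'I_N -> 'cV[R]_m) (hxi : forall i, polyhedron C d (xi i))
    (a : 'I_K -> 'cV[R]_m) (b : 'I_K -> R)
    (eps : R) (heps : 0 <= eps) :
  (forall ell : 'cV[R]_m -> R,
     (forall x, (ell x)%:E = \big[maxe/-oo%E]_(k < K) (dot (a k) x + b k)%:E) ->
     worst_case_expectation nrm (polyhedron C d) eps xi ell =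
     ereal_inf [set v : \bar R |
       exists (lam : R) (s : 'I_N -> R) (gam : 'I_N -> 'I_K -> 'cV[R]_p),
         [/\ forall i k, b k + dot (a k) (xi i)
                         + dot (gam i k) (d - C *m xi i) <= s i,
             forall i k, (dual_norm nrm (C^T *m gam i k - a k) <= lam%:E)%E,
             forall i k, cv_le 0 (gam i k) &
             v = (lam * eps + N%:R^-1 * \sum_(i < N) s i)%:E]])
  /\
  (forall ell : 'cV[R]_m -> R,
     (forall x, (ell x)%:E = \big[mine/+oo%E]_(k < K) (dot (a k) x + b k)%:E) ->
     let A : 'M[R]_(K, m) := \matrix_(k < K, j < m) a k j ord0 in
     let bv : 'cV[R]_K := \col_(k < K) b k in
     let e : 'cV[R]_K := const_mx 1 in
     worst_case_expectation nrm (polyhedron C d) eps xi ell =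
     ereal_inf [set v : \bar R |
       exists (lam : R) (s : 'I_N -> R) (gam : 'I_N -> 'cV[R]_p)
              (theta : 'I_N -> 'cV[R]_K),
         [/\ forall i, dot (theta i) (bv + A *m xi i)
                       + dot (gam i) (d - C *m xi i) <= s i,
             forall i, (dual_norm nrm (C^T *m gam i - A^T *m theta i)
                        <= lam%:E)%E,
             forall i, dot (theta i) e = 1,
             forall i, cv_le 0 (gam i) /\ cv_le 0 (theta i) &
             v = (lam * eps + N%:R^-1 * \sum_(i < N) s i)%:E]]).
Proof.
have [L L0 LP] := affine_family_lipschitz hnrm a b.
have mXi := measurable_polyhedron hnrm C d.
split => [ell ellE|ell ellE A bv e].
  have lip x y : `|ell x - ell y| <= L * nrm (x - y).
    have one u v : ell u - ell v <= L * nrm (u - v).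
      have [_ [k uE]] := max_attained hK (ellE u).
      have [/(_ k) vk _] := max_attained hK (ellE v).
      by have := LP k u v; rewrite ler_norml uE => /andP[_]; lra.
    by have := one x y; have := one y x; rewrite ler_norml (nrmB hnrm y); lra.
  rewrite (worst_case_semi_dual hnrm hN mXi hxi L0 lip heps); congr ereal_inf.
  apply/seteqP; split => v /= [lam [s]].
    move=> [[lam0 feas] ->]; exists lam, s.
    have /choice[gam gamP] (ik : 'I_N * 'I_K) : exists gam : 'cV[R]_p,
        [/\ b ik.2 + dot (a ik.2) (xi ik.1)
              + dot gam (d - C *m xi ik.1) <= s ik.1,
            (dual_norm nrm (C^T *m gam - a ik.2) <= lam%:E)%E & cv_le 0 gam].
      case: ik => i k /=.
      (* A single affine piece, for which theta is the number 1. *)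
      have [|gam [theta []]] := polyhedral_dual_certificate hnrm (hxi i)
          (a := fun _ : 'I_1 => a k) (b := fun=> b k) (s := s i) lam0.
        move=> x Px; exists ord0; apply: le_trans (feas i x Px).
        by have [] := max_attained hK (ellE x).
      rewrite !big_ord1 => gam0 _ theta1 val dual; exists gam; split => //.
        by move: val; rewrite theta1 mul1r [b k + _]addrC.
      apply/(dual_norm_leP hnrm); split=> // y.
      by have := dual y; rewrite big_ord1 theta1 mul1r dotBl dot_trmx; apply.
    exists (fun i k => gam (i, k)); split => // i k; by case: (gamP (i, k)).
  move=> [gam [val dual gam0 ->]]; exists lam, s; split => //; split.
    by have [] := (dual_norm_leP hnrm _ _).1 (dual (Ordinal hN) (Ordinal hK)).
  move=> i x Px; have [_ [k ->]] := max_attained hK (ellE x).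
  exact: certificate_sound (val i k) (dual i k) (gam0 i k) x Px.
have AE x k : (A *m x) k ord0 = dot (a k) x.
  by rewrite dotE mxE; apply: eq_bigr => j _; rewrite !mxE.
have thetaA (theta : 'cV[R]_K) x :
    dot (A^T *m theta) x = \sum_k theta k ord0 * dot (a k) x.
  by rewrite dot_trmx dotE; apply: eq_bigr => k _; rewrite AE.
have thetab (theta : 'cV[R]_K) x :
    dot theta (bv + A *m x) = \sum_k theta k ord0 * (dot (a k) x + b k).
  by rewrite dotE; apply: eq_bigr => k _; rewrite mxE AE mxE addrC.
have thetae (theta : 'cV[R]_K) : dot theta e = \sum_k theta k ord0.
  by rewrite dotE; apply: eq_bigr => k _; rewrite mxE mulr1.
have lip x y : `|ell x - ell y| <= L * nrm (x - y).
  have one u v : ell u - ell v <= L * nrm (u - v).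
    have [_ [k vE]] := min_attained hK (ellE v).
    have [/(_ k) uk _] := min_attained hK (ellE u).
    by have := LP k u v; rewrite ler_norml vE => /andP[_]; lra.
  by have := one x y; have := one y x; rewrite ler_norml (nrmB hnrm y); lra.
rewrite (worst_case_semi_dual hnrm hN mXi hxi L0 lip heps); congr ereal_inf.
apply/seteqP; split => v /= [lam [s]].
  move=> [[lam0 feas] ->]; exists lam, s.
  have /choice[g gP] i : exists g : 'cV[R]_p * 'cV[R]_K,
      [/\ dot g.2 (bv + A *m xi i) + dot g.1 (d - C *m xi i) <= s i,
          (dual_norm nrm (C^T *m g.1 - A^T *m g.2) <= lam%:E)%E,
          dot g.2 e = 1 & cv_le 0 g.1 /\ cv_le 0 g.2].
    have [|gam [theta [gam0 theta0 sum1 val dual]]] :=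
      polyhedral_dual_certificate hnrm (hxi i) (a := a) (b := b) (s := s i) lam0.
      move=> x Px; have [_ [k kE]] := min_attained hK (ellE x).
      by exists k; rewrite -kE; exact: feas.
    exists (gam, theta); split => //=; first by rewrite thetab.
      apply/(dual_norm_leP hnrm); split=> // y.
      by rewrite dotBl dot_trmx thetaA; exact: dual.
    by rewrite thetae.
  exists (fun i => (g i).1), (fun i => (g i).2).
  by split => // i; case: (gP i).
move=> [gam [theta [val dual sum1 ge0 ->]]]; exists lam, s; split => //; split.
  by have [] := (dual_norm_leP hnrm _ _).1 (dual (Ordinal hN)).
move=> i x Px; have [gam0 theta0] := ge0 i.
apply: (@le_trans _ _ (dot (theta i) (bv + A *m x))).
  have := sum1 i; rewrite thetae thetab => sum1i.
  rewrite -[ell x]mul1r -sum1i mulr_suml ler_sum// => k _.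
  have := theta0 k; rewrite mxE => tk; rewrite ler_wpM2l//.
  by have [] := min_attained hK (ellE x).
rewrite dotDr -dot_trmx addrC.
apply: (certificate_sound hnrm _ (dual i) gam0 Px).
by rewrite dot_trmx -dotDr.
Qed.
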